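(* Let $X$ be a real Banach space and $k\in\mathbb{Z}^+$. Consider the following statements. (1) $X$ is $k$-WLUR. (2) $S_X$ is $k$-$w$SCh on $rS_X$ for some $r\in(0,1)$. (3) $(S_X,C)$ has property $k$-$w$UC, whenever $C$ is a non-empty boundedly compact subset of $X$ with $d(0,C)>0$. Then $(2)\Rightarrow(1)$ and $(2)\Leftrightarrow(3)$.
   Context: $S_X$ is the unit sphere of $X$; $X^*$ is the dual. For $x_1,\dots,x_{k+1}\in X$ and $f_1,\dots,f_k\in X^*$, $D_k[(x_i)_{i=1}^{k+1};(f_j)_{j=1}^{k}]$ denotes the determinant of the $(k+1)\times(k+1)$ matrix whose first row consists of ones and whose $(j+1,i)$ entry is $f_j(x_i)$. $X$ is $k$-weakly locally uniformly rotund ($k$-WLUR) if for every $x\in S_X$, $\epsilon>0$ and $f_1,\dots,f_k\in S_{X^*}$, $$\inf\Big(\{1\}\cup\Big\{1-\tfrac{1}{k+1}\Big\|x+\sum_{i=1}^{k}x_i\Big\| : x_1,\dots,x_{k}\in S_X,\ |D_k[x,(x_i)_{i=1}^{k};(f_j)_{j=1}^{k}]|\ge\epsilon\Big\}\Big)>0.$$ For a non-empty $A\subseteq X$, $x\in X$, $\delta>0$: $d(x,A)=\inf\{\|x-y\|:y\in A\}$ and $P_A(x,\delta)=\{y\in A:\|x-y\|\le d(x,A)+\delta\}$. $A$ is proximinal at $x$ if there is $y\in A$ with $\|x-y\|=d(x,A)$. $A$ is $k$-weakly strongly Chebyshev ($k$-$w$SCh) at $x$ if $A$ is proximinal at $x$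 and for every $\epsilon>0$ and $f_1,\dots,f_k\in S_{X^*}$ there exists $\delta>0$ such that $|D_k[(x_i)_{i=1}^{k+1};(f_j)_{j=1}^{k}]|\le\epsilon$ whenever $x_1,\dots,x_{k+1}\in P_A(x,\delta)$. $A$ is $k$-$w$SCh on $B\subseteq X$ if it is $k$-$w$SCh at every $x\in B$. For non-empty $A,B\subseteq X$, $d(A,B)=\inf\{\|x-y\|:x\in A,y\in B\}$. The pair $(A,B)$ has property $k$-weakly UC (property $k$-$w$UC) if for any sequences $(x_n^{(1)}),\dots,(x_n^{(k+1)})$ in $A$ and any sequence $(y_n)$ in $B$ with $\|x_n^{(i)}-y_n\|\to d(A,B)$ for all $1\le i\le k+1$, it follows that $D_k[(x_n^{(i)})_{i=1}^{k+1};(f_j)_{j=1}^{k}]\to 0$ for all $f_1,\dots,f_k\in S_{X^*}$. A set is boundedly compact if its intersection with every closed ball is compact. *)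

(* Defs.v *)
From mathcomp Require Import all_boot all_order all_algebra.
From mathcomp Require Import all_classical all_reals all_analysis.

Set Implicit Arguments.
Unset Strict Implicit.
Unset Printing Implicit Defensive.

Import Order.TTheory GRing.Theory Num.Theory.
Import numFieldTopology.Exports numFieldNormedType.Exports.

Local Open Scope classical_set_scope.
Local Open Scope ring_scope.

Definition unit_sphere (R : realType) (X : normedModType R) : set X :=
  [set x | `|x| = 1].
Arguments unit_sphere {R} X.

(* The supremum is taken in R, so it is the operator norm only for bounded,
   i.e. continuous, functionals. *)
Definition dual_norm (R : realType) (X : normedModType R) (f : {scalar X}) : R :=
  sup [set `|f x| | x in [set x : X | `|x| <= 1]].

(* [{scalar X}] contains the discontinuous linear functionals too, hence the
   first conjunct. *)
Definition dual_unit_sphere (R : realType) (X : normedModType R) :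
    set {scalar X} :=
  [set f : {scalar X} | continuous (f : X -> R) /\ dual_norm f = 1].
Arguments dual_unit_sphere {R} X.

(* Row 0 consists of ones, row j+1 of the values of [f j]. *)
Definition Dk (R : realType) (X : normedModType R) (k : nat)
    (x : 'I_k.+1 -> X) (f : 'I_k -> {scalar X}) : R :=
  \det (\matrix_(j < k.+1, i < k.+1)
          if unlift ord0 j is Some j' then f j' (x i) else 1).

(* The (k+1)-tuple x, x_1, ..., x_k. *)
Definition cons_pt (T : Type) (k : nat) (x : T) (xs : 'I_k -> T)
    (i : 'I_k.+1) : T :=
  if unlift ord0 i is Some i' then xs i' else x.

Definition kWLUR (R : realType) (X : normedModType R) (k : nat) : Prop :=
  forall (x : X) (eps : R) (f : 'I_k -> {scalar X}),
    unit_sphere X x -> 0 < eps -> (forall j, dual_unit_sphere X (f j)) ->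
    0 < inf ([set 1] `|`
             [set 1 - (k.+1%:R)^-1 * `|x + \sum_(i < k) xs i| |
               xs in [set xs : 'I_k -> X |
                       (forall i, unit_sphere X (xs i)) /\
                       eps <= `|Dk (cons_pt x xs) f|]]).

(* The two distances are meaningful for non-empty sets only ([inf set0 = 0]). *)
Definition dist_pt (R : realType) (X : normedModType R) (x : X) (A : set X) : R :=
  inf [set `|x - y| | y in A].

Definition dist_sets (R : realType) (X : normedModType R) (A B : set X) : R :=
  inf [set `|x - y| | x in A & y in B].

Definition near_proj (R : realType) (X : normedModType R)
    (A : set X) (x : X) (delta : R) : set X :=
  [set y | A y /\ `|x - y| <= dist_pt x A + delta].

Definition proximinal_at (R : realType) (X : normedModType R)
    (A : set X) (x : X) : Prop :=
  exists2 y, A y & `|x - y| = dist_pt x A.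

Definition kwSCh_at (R : realType) (X : normedModType R) (k : nat)
    (A : set X) (x : X) : Prop :=
  proximinal_at A x /\
  forall (eps : R) (f : 'I_k -> {scalar X}),
    0 < eps -> (forall j, dual_unit_sphere X (f j)) ->
    exists2 delta : R, 0 < delta &
      forall xs : 'I_k.+1 -> X,
        (forall i, near_proj A x delta (xs i)) -> `|Dk xs f| <= eps.

Definition kwSCh_on (R : realType) (X : normedModType R) (k : nat)
    (A B : set X) : Prop :=
  forall x, B x -> kwSCh_at k A x.

Definition kwUC (R : realType) (X : normedModType R) (k : nat)
    (A B : set X) : Prop :=
  forall (x : 'I_k.+1 -> nat -> X) (y : nat -> X),
    (forall i n, A (x i n)) -> (forall n, B (y n)) ->
    (forall i, `|x i n - y n| @[n --> \oo] --> dist_sets A B) ->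
    forall f : 'I_k -> {scalar X}, (forall j, dual_unit_sphere X (f j)) ->
      Dk (fun i => x i n) f @[n --> \oo] --> (0 : R).

Definition boundedly_compact (R : realType) (X : normedModType R)
    (A : set X) : Prop :=
  forall (x : X) (r : R), 0 < r -> compact (A `&` closed_ball x r).

(* Main.v *)
(* Everything reduces to the property [kwFace] below: if [x_i] and [s] are unit
   vectors with [|x_i + s|] close to 2, then [D_k] of the [x_i] is small.
   If [|x + s|] is close to 2, then [z = r s + (1 - r) x] is almost a unit vector
   at distance [1 - r] from [r s], and the affine map [x |-> z] multiplies [D_k]
   by [(1 - r) ^+ k]; so (2) for a single [r] implies [kwFace].  Conversely a
   unit vector almost nearest to [t s], with [t > 0] on either side of the sphere,
   satisfies [|x + s|] close to 2, which gives (3) by compactness, and (3)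
   applied to the singletons [{r s}] gives (2).  For (1), note that if the mean of
   [x], [x_1], ..., [x_k] has norm close to 1, then each [|x_i + x|] is close to 2. *)
Require Import Defs.
From mathcomp Require Import all_boot all_order all_algebra.
From mathcomp Require Import all_classical all_reals all_analysis.
From mathcomp Require Import perm lra.

Set Implicit Arguments.
Unset Strict Implicit.
Unset Printing Implicit Defensive.

Import Order.TTheory GRing.Theory Num.Theory.
Import numFieldTopology.Exports numFieldNormedType.Exports.

Local Open Scope classical_set_scope.
Local Open Scope ring_scope.

(** * Perturbation estimates for products, determinants and [Dk] *)

(** Telescoping: factors are exchanged one at a time while all others have modulus at most 1. The
    induction also carries the bound on the product of the [b i]. *)
Lemma ler_norm_prodB (R : numDomainType) (I : Type) (s : seq I) (a b : I -> R) :
  (forall i, `|a i| <= 1) -> (forall i, `|b i| <= 1) ->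
  `|\prod_(i <- s) a i - \prod_(i <- s) b i| <= \sum_(i <- s) `|a i - b i|.
Proof.
move=> a1 b1.
suff [//] : `|\prod_(i <- s) a i - \prod_(i <- s) b i| <=
    \sum_(i <- s) `|a i - b i| /\ `|\prod_(i <- s) b i| <= 1.
elim: s => [|i s [IH1 IH2]]; first by rewrite !big_nil subrr normr0 normr1.
rewrite !big_cons; split; last by rewrite normrM mulr_ile1.
rewrite -[a i * _](subrK (a i * \prod_(j <- s) b j)) -mulrBr -addrA -mulrBl.
rewrite addrC; apply: le_trans (ler_normD _ _) _; rewrite !normrM.
by apply: lerD; [rewrite ler_piMr | apply: le_trans IH1; rewrite ler_piMl].
Qed.

(** In the Leibniz expansion each of the [n!] products changes by at most [n * e]. *)
Lemma ler_norm_detB (R : numDomainType) (n : nat) (A B : 'M[R]_n) (e : R) :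
  (forall i j, `|A i j| <= 1) -> (forall i j, `|B i j| <= 1) ->
  (forall i j, `|A i j - B i j| <= e) ->
  `|\det A - \det B| <= (n`! * n)%:R * e.
Proof.
move=> A1 B1 AB.
rewrite /determinant -sumrB; apply: le_trans (ler_norm_sum _ _ _) _.
have -> : (n`! * n)%:R * e = \sum_(s : 'S_n) \sum_(i < n) e.
  by rewrite !sumr_const card_ord card_Sn -mulrnA mulnC mulr_natl.
apply: ler_sum => s _; rewrite -mulrBr normrMsign.
apply: le_trans (ler_norm_prodB _ _ _) _ => //.
exact: ler_sum.
Qed.

Lemma ler_dual_unit (R : realType) (X : normedModType R) (f : {scalar X}) x :
  dual_unit_sphere X f -> `|f x| <= `|x|.
Proof.
move=> [cf f1].
have [->|x0] := eqVneq x 0; first by rewrite linear0 !normr0.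
have nx0 : 0 < `|x| by rewrite normr_gt0.
(* Continuity makes the set under the supremum bounded, so that [sup] really is an upper bound of
   it. *)
have [M fM] : exists M : R, forall x, `|f x| <= M * `|x|.
  have /linear_boundedP/pinfty_ex_gt0 [M _ fM] :
    bounded_near f (nbhs (0 : X)) by exact/continuous_linear_bounded/cf.
  by exists M.
have ub : has_ubound [set `|f x| | x in [set x : X | `|x| <= 1]].
  exists (Num.max M 0) => _ [y /= y1 <-]; apply: le_trans (fM y) _.
  apply: le_trans (_ : Num.max M 0 * `|y| <= _).
    by rewrite ler_wpM2r // le_max lexx.
  by rewrite ler_piMr // le_max lexx orbT.
have /(ub_le_sup ub) : [set `|f x| | x in [set x : X | `|x| <= 1]]
    `|f (`|x|^-1 *: x)|.
  by exists (`|x|^-1 *: x) => //=; rewrite normrZ normfV normr_id mulVf ?gt_eqF.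
rewrite -/(dual_norm f) f1 linearZ /= normrM normfV normr_id.
by rewrite mulrC ler_pdivrMr // mul1r.
Qed.

Lemma ler_norm_DkB (R : realType) (X : normedModType R) (k : nat)
    (f : 'I_k -> {scalar X}) (u v : 'I_k.+1 -> X) (e : R) :
  (forall j, dual_unit_sphere X (f j)) -> 0 <= e ->
  (forall i, `|u i| <= 1) -> (forall i, `|v i| <= 1) ->
  (forall i, `|u i - v i| <= e) ->
  `|Dk u f - Dk v f| <= (k.+1`! * k.+1)%:R * e.
Proof.
move=> hf e0 u1 v1 uv.
apply: ler_norm_detB => i j; rewrite !mxE; case: unliftP => [i' _|_];
  rewrite ?normr1 ?subrr ?normr0 //.
- exact: le_trans (ler_dual_unit _ (hf _)) (u1 _).
- exact: le_trans (ler_dual_unit _ (hf _)) (v1 _).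
- by rewrite -linearB; exact: le_trans (ler_dual_unit _ (hf _)) (uv _).
Qed.

(* The affine change of variable acts on the rows by a lower triangular matrix. *)
Lemma Dk_affine (R : realType) (X : normedModType R) (k : nat)
    (f : 'I_k -> {scalar X}) (x : 'I_k.+1 -> X) (z : X) (a : R) :
  Dk (fun i => z + a *: x i) f = a ^+ k * Dk x f.
Proof.
(* Column 0 holds 1 and the [f i z]; the rest of the diagonal is [a]. Left multiplication by [L]
   fixes the row of ones and adds [f i z] times it to [a] times row [i]. *)
pose L : 'M[R]_k.+1 := \matrix_(i, j)
  if unlift ord0 i is Some i' then (j == ord0)%:R * f i' z + (i == j)%:R * a
  else (j == ord0)%:R.
have trigL : is_trig_mx L.
  apply/is_trig_mxP => i j ij; rewrite mxE.
  have -> : (j == ord0) = false by apply/eqP => j0; rewrite j0 in ij.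
  have -> : (i == j) = false by apply/eqP => e; rewrite e ltnn in ij.
  by case: unliftP => [? _|//]; rewrite !mul0r addr0.
have -> : a ^+ k = \det L.
  rewrite det_trig // big_ord_recl mxE unlift_none eqxx mul1r.
  under eq_bigr => i _ do rewrite mxE liftK eqxx mul1r mul0r add0r.
  by rewrite prodr_const card_ord.
rewrite /Dk -det_mulmx; congr (\det _); apply/matrixP => i j.
rewrite !mxE; case: unliftP => [i' ->|->].
  rewrite linearD linearZ big_ord_recl !mxE liftK unlift_none /= mul1r.
  rewrite mul0r addr0 mulr1; congr (_ + _).
  rewrite (bigD1 i') //= !mxE !liftK eqxx mul1r mul0r add0r big1 ?addr0 //.
  move=> j' j'i; rewrite !mxE !liftK mul0r add0r (inj_eq lift_inj).
  by rewrite eq_sym (negPf j'i) !mul0r.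
rewrite big_ord_recl !mxE unlift_none mulr1 big1 ?addr0 // => j' _.
by rewrite !mxE unlift_none mul0r.
Qed.

(** * Distances to the unit sphere *)

(** Triangle inequality for [(1 + t) s = (x + s) + (t s - x)] if [t >= 1], and for
    [(1 + t) x = t (x + s) - (t s - x)] if [t <= 1]; the second case costs the factor [t]. *)
Lemma near_sphere_norm (R : realType) (X : normedModType R) (s x : X) (t d : R) :
  `|s| = 1 -> `|x| = 1 -> 0 <= t -> `|t *: s - x| <= `|1 - t| + d ->
  Num.min 1 t * (2 - `|x + s|) <= d.
Proof.
move=> s1 x1 t0 h; have [t1|/ltW t1] := leP 1 t.
  have : `|(1 + t) *: s| <= `|x + s| + `|t *: s - x|.
    apply: le_trans (ler_normD _ _).
    by rewrite (addrC x) addrACA subrr addr0 scalerDl scale1r.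
  rewrite normrZ s1 mulr1 ger0_norm; last lra.
  by move: h; rewrite ler0_norm; lra.
have : `|(1 + t) *: x| <= `|t *: (x + s)| + `|t *: s - x|.
  rewrite -[X in _ <= _ + X]normrN; apply: le_trans (ler_normD _ _).
  by rewrite opprB scalerDr addrACA subrr addr0 addrC scalerDl scale1r.
rewrite !normrZ x1 mulr1 ger0_norm ?(ger0_norm t0); last lra.
by move: h; rewrite ger0_norm; [nra|lra].
Qed.

Lemma dist_pt_le (R : realType) (X : normedModType R) (x y : X) (A : set X) :
  A y -> dist_pt x A <= `|x - y|.
Proof. by move=> Ay; apply: ge_inf; [exists 0 => _ [? _ <-]|exists y]. Qed.

Lemma dist_sets_le (R : realType) (X : normedModType R) (x y : X) (A B : set X) :
  A x -> B y -> dist_sets A B <= `|x - y|.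
Proof.
by move=> Ax By; apply: ge_inf; [exists 0 => _ [? _ [? _ <-]]|exists x => //; exists y].
Qed.

Lemma dist_sets1 (R : realType) (X : normedModType R) (A : set X) (y : X) :
  dist_sets A [set y] = dist_pt y A.
Proof.
congr inf; apply/seteqP; split => [_ [x Ax [_ -> <-]]|_ [x Ax <-]].
  by exists x => //; rewrite distrC.
by exists x => //; exists y => //; rewrite distrC.
Qed.

(** The reverse triangle inequality gives the lower bound, and [s] attains it. *)
Lemma dist_sphere (R : realType) (X : normedModType R) (s : X) (t : R) :
  `|s| = 1 -> 0 <= t -> dist_pt (t *: s) (unit_sphere X) = `|1 - t|.
Proof.
move=> s1 t0; have ts : `|t *: s - s| = `|1 - t|.
  by rewrite -[X in _ - X]scale1r -scalerBl normrZ s1 mulr1 distrC.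
apply/eqP; rewrite eq_le -{1}ts dist_pt_le //=.
apply: lb_le_inf => [|_ [y /= y1 <-]]; first by exists `|t *: s - s|; exists s.
rewrite -[X in `|X - t|]y1 -[t in `|_ - t|]ger0_norm // -[`|t|]mulr1 -s1 -normrZ.
by rewrite (distrC _ y); exact: ler_dist_dist.
Qed.

Lemma boundedly_compact_set1 (R : realType) (X : normedModType R) (y : X) :
  boundedly_compact [set y].
Proof.
by move=> x r _; apply: compact_closedI; [exact: compact_set1|exact: closed_ball_closed].
Qed.

(** * The implications through [kwFace] *)

(* [|x + s| = 2] for unit vectors means that they lie on a common face of the
   unit ball. *)
Definition kwFace (R : realType) (X : normedModType R) (k : nat) : Prop :=
  forall (s : X) (eps : R) (f : 'I_k -> {scalar X}),
    unit_sphere X s -> 0 < eps -> (forall j, dual_unit_sphere X (f j)) ->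
    exists2 d : R, 0 < d &
      forall xs : 'I_k.+1 -> X, (forall i, unit_sphere X (xs i)) ->
        (forall i, 2 - d <= `|xs i + s|) -> `|Dk xs f| <= eps.

Lemma kwSCh_kwFace (R : realType) (X : normedModType R) (k : nat) (r : R) :
  0 < r -> r < 1 ->
  kwSCh_on k (unit_sphere X) [set r *: x | x in unit_sphere X] -> kwFace X k.
Proof.
move=> r0 r1 H s eps f s1 eps0 hf.
(* One half of the tolerance is for [Dk w f], the other for replacing [w] by [z]; the factor
   [(1 - r) ^+ k] cancels at the end. *)
have [_ /(_ ((1 - r) ^+ k * eps / 2) f)] := H _ (ex_intro2 _ _ s s1 erefl).
set e := (1 - r) ^+ k * eps / 2.
have r1' : 0 < 1 - r by rewrite subr_gt0.
have e0 : 0 < e by rewrite divr_gt0 // mulr_gt0 // exprn_gt0.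
case=> // delta delta0 Hd.
set M : R := (k.+1`! * k.+1)%:R.
have M0 : 0 < M by rewrite ltr0n muln_gt0 fact_gt0.
(* The three bounds put [w i] in the near projection, keep [z i] away from 0, and make the
   normalisation change [Dk] by at most [e]. *)
exists (Num.min delta (Num.min 2^-1 (e / M))).
  by rewrite !lt_min delta0 invr_gt0 ltr0n divr_gt0.
set d := Num.min _ _ => xs xs1 hxs.
have [d_delta d_half d_M] : [/\ d <= delta, d <= 2^-1 & d <= e / M].
  by split; rewrite /d !ge_min lexx ?orbT.
pose z i := r *: s + (1 - r) *: xs i.
pose w i := `|z i|^-1 *: z i.
have z_le1 i : `|z i| <= 1.
  apply: le_trans (ler_normD _ _) _; rewrite !normrZ s1 (xs1 i) !gtr0_norm //.
  by lra.
(* [xs i + s] is the sum of [z i] and its mirror convex combination, which has norm at most 1. *)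
have z_ge i : 1 - d <= `|z i|.
  have : `|xs i + s| <= `|z i| + `|(1 - r) *: s + r *: xs i|.
    apply: le_trans (ler_normD _ _); rewrite addrACA -!scalerDl.
    by rewrite addrCA subrr addr0 subrK !scale1r addrC.
  have : `|(1 - r) *: s + r *: xs i| <= 1.
    apply: le_trans (ler_normD _ _) _; rewrite !normrZ s1 (xs1 i) !gtr0_norm //.
    by lra.
  by have := hxs i; lra.
have z_gt0 i : 0 < `|z i| by have := z_ge i; lra.
have w1 i : `|w i| = 1 by rewrite normrZ normfV normr_id mulVf ?gt_eqF.
have wz i : `|z i - w i| <= d.
  rewrite -[X in X - _]scale1r -scalerBl normrZ -[X in _ * X]ger0_norm //.
  rewrite -normrM mulrBl mul1r mulVf ?gt_eqF // distrC ger0_norm.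
    by have := z_ge i; lra.
  by rewrite subr_ge0.
have Dw : `|Dk w f| <= e.
  apply: Hd => // i; split; first exact: w1.
  rewrite dist_sphere ?(ltW r0) // gtr0_norm //.
  apply: le_trans (ler_distD (z i) _ _) (lerD _ (le_trans (wz i) d_delta)).
  by rewrite opprD addrA subrr add0r normrN normrZ xs1 mulr1 gtr0_norm.
have Dzw : `|Dk z f - Dk w f| <= e.
  apply: (@le_trans _ _ (M * d)).
    apply: ler_norm_DkB => // [|i]; last by rewrite w1.
    exact: le_trans (normr_ge0 _) (wz ord0).
  by rewrite mulrC -ler_pdivlMr.
have : `|Dk z f| <= 2 * e.
  have := ler_normD (Dk z f - Dk w f) (Dk w f).
  by rewrite subrK; lra.
rewrite Dk_affine normrM ger0_norm ?exprn_ge0 ?(ltW r1') //.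
have -> : 2 * e = (1 - r) ^+ k * eps by rewrite mulrC divfK.
by rewrite ler_pM2l // exprn_gt0.
Qed.

Lemma kwFace_kWLUR (R : realType) (X : normedModType R) (k : nat) :
  kwFace X k -> kWLUR X k.
Proof.
move=> H x eps f x1 eps0 hf.
have [d d0 Hd] := H x (eps / 2) f x1 (divr_gt0 eps0 (ltr0Sn R 1)) hf.
have k0 : (0 : R) < k.+1%:R by rewrite ltr0n.
apply: (@lt_le_trans _ _ (Num.min 1 (d / k.+1%:R))).
  by rewrite lt_min ltr01 divr_gt0.
apply: lb_le_inf; first by exists 1; left.
move=> _ [->|[xs [xs1 big] <-]]; first by rewrite ge_min lexx.
rewrite ge_min; apply/orP; right; rewrite leNgt; apply/negP => small.
have lb : k.+1%:R - d < `|x + \sum_(i < k) xs i|.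
  move: small; rewrite ltrBlDr -ltrBlDl ltr_pdivlMl //.
  by rewrite mulrBr mulr1 mulrCA divff ?gt_eqF // mulr1.
suff : `|Dk (cons_pt x xs) f| <= eps / 2 by move: big; lra.
have sph i : unit_sphere X (cons_pt x xs i).
  by rewrite /cons_pt; case: unliftP.
apply: Hd => // i; rewrite /cons_pt; case: unliftP => [j _|_]; last first.
  by rewrite -mulr2n normrMn x1; lra.
move: lb; rewrite (bigD1 j) //= addrA => lb.
(* Discarding the other [k - 1] unit vectors from a sum of norm above [k + 1 - d] leaves [x + xs j]
   with norm above [2 - d]. *)
have tail : `|\sum_(i < k | i != j) xs i| <= k%:R - 1.
  apply: le_trans (ler_norm_sum _ _ _) _.
  under eq_bigr => l _ do rewrite xs1.
  suff -> : k%:R = 1 + \sum_(i < k | i != j) (1 : R) by rewrite (addrC 1) addrK.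
  by rewrite -(bigD1 (P := predT) j) // sumr_const card_ord.
have := ler_normD (x + xs j) (\sum_(i < k | i != j) xs i).
by rewrite (addrC (xs j)); move: lb; rewrite -natr1; lra.
Qed.

(** The [d] of [kwFace] depends on the direction [s]; compactness, as a near-covering property,
    makes the estimate uniform over the directions of the [y n]. *)
Lemma kwFace_kwUC (R : realType) (X : normedModType R) (k : nat) (C : set X) :
  kwFace X k -> boundedly_compact C -> 0 < dist_pt 0 C ->
  kwUC k (unit_sphere X) C.
Proof.
move=> H bC C0 x y xS yC cvx f hf.
pose d0 := dist_sets (unit_sphere X) C.
have d0_ge0 : 0 <= d0.
  apply: lb_le_inf; last by move=> _ [? _ [? _ <-]].
  by exists `|x ord0 0%N - y 0%N|, (x ord0 0%N) => //; exists (y 0%N).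
have near_x e : 0 < e -> \forall n \near \oo, forall i, `|x i n - y n| <= d0 + e.
  move=> e0; apply: filter_forall => i.
  have /cvgrPdist_le/(_ _ e0) := cvx i.
  by apply: filterS => n; rewrite ler_distlC => /andP[].
(* Eventually [y n] has norm at most [1 + (d0 + 1)]. *)
have /compact_near_coveringP cK := bC 0 (d0 + 2) (ltr_wpDl d0_ge0 (ltr0Sn R 1)).
apply/cvgr0Pnorm_le => eps eps0.
(* The premise lets the estimate near each [z] be applied at the moving point [y n]. *)
pose P n z := y n = z -> `|Dk (x ^~ n) f| <= eps.
suff /(cK nat \oo P _) : forall z, (C `&` closed_ball 0 (d0 + 2)) z ->
    \forall z' \near z & n \near \oo, P n z'.
  apply: filterS2 (near_x 1 ltr01) => n xn1; apply => //.
  split => //; rewrite closed_ballE; last by lra.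
  rewrite /closed_ball_ /= sub0r normrN.
  have := ler_normB (x ord0 n) (x ord0 n - y n).
  by rewrite opprB addrC subrK (xS ord0 n); have := xn1 ord0; lra.
move=> z [Cz _]; pose t := `|z|; pose s := t^-1 *: z.
have t0 : 0 < t.
  by apply: lt_le_trans C0 _; rewrite -[t]normrN -sub0r; exact: dist_pt_le.
have ts : t *: s = z by rewrite scalerA mulfV ?gt_eqF // scale1r.
have s1 : `|s| = 1 by rewrite normrZ normfV normr_id mulVf ?gt_eqF.
have [d dgt0 Hd] := H s eps f s1 eps0 hf.
have m0 : 0 < Num.min 1 t by rewrite lt_min ltr01.
(* Two errors of size [e] add up: [y n] against [z], and the distance from [x i n] to [y n] against
   [d0]. *)
pose e := Num.min 1 t * d / 2.
have e0 : 0 < e by rewrite divr_gt0 // mulr_gt0.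
exists (ball z e, [set n | forall i, `|x i n - y n| <= d0 + e]).
  by split; [exact: nbhsx_ballx|exact: near_x].
move=> [z' n] /= [zz' xn] ynz'; apply: Hd => [i|i]; first exact: xS.
have d0_le : d0 <= `|1 - t|.
  have -> : `|1 - t| = `|s - z|.
    by rewrite -ts -[X in X - t *: _]scale1r -scalerBl normrZ s1 mulr1.
  exact: dist_sets_le.
suff : Num.min 1 t * (2 - `|x i n + s|) <= 2 * e.
  have -> : 2 * e = Num.min 1 t * d by rewrite mulrC divfK.
  by rewrite ler_pM2l //; lra.
apply: near_sphere_norm => //; [exact: xS|exact: ltW|].
rewrite ts; apply: le_trans (ler_distD (y n) _ _) _.
move: (xn i) zz'; rewrite -ball_normE /ball_ /= -ynz' (distrC (y n)).
by lra.
Qed.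

(** If no [delta] works, bad tuples for [delta = 1 / (n + 1)] form sequences that violate [kwUC]
    against the constant sequence [r *: s]. *)
Lemma kwUC_kwSCh (R : realType) (X : normedModType R) (k : nat) (r : R) :
  0 < r -> r < 1 ->
  (forall C : set X, C !=set0 -> boundedly_compact C ->
      0 < dist_pt 0 C -> kwUC k (unit_sphere X) C) ->
  kwSCh_on k (unit_sphere X) [set r *: x | x in unit_sphere X].
Proof.
move=> r0 r1 H _ [s s1 <-]; split.
  exists s => //; rewrite dist_sphere ?(ltW r0) //.
  by rewrite -[X in _ - X]scale1r -scalerBl normrZ s1 mulr1 distrC.
move=> eps f eps0 hf; apply: contrapT => no.
have ex (n : nat) : exists xs : 'I_k.+1 -> X,
    (forall i, near_proj (unit_sphere X) (r *: s) n.+1%:R^-1 (xs i)) /\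
    eps < `|Dk xs f|.
  apply: contrapT => nxs; apply: no; exists n.+1%:R^-1 => // xs hxs.
  by rewrite leNgt; apply/negP => lt; apply: nxs; exists xs.
have {ex} [xs hxs] := choice ex.
have rs_gt0 : 0 < dist_pt 0 [set r *: s].
  apply: (@lt_le_trans _ _ r) => //.
  apply: lb_le_inf; first by exists `|0 - r *: s|, (r *: s).
  by move=> _ [_ -> <-]; rewrite sub0r normrN normrZ s1 mulr1 gtr0_norm.
have UC := H _ (ex_intro _ _ erefl) (@boundedly_compact_set1 _ _ (r *: s)) rs_gt0.
have lim i : `|xs n i - r *: s| @[n --> \oo] -->
    dist_sets (unit_sphere X) [set r *: s].
  rewrite dist_sets1; apply/cvgrPdist_lt => e e0.
  apply: filterS (near_infty_natSinv_lt (PosNum e0)) => n /= ne.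
  have [/(_ i)[xS xd] _] := hxs n.
  have := dist_pt_le (r *: s) xS; rewrite ltr_distlC (distrC (xs n i)) => xd'.
  by rewrite (le_lt_trans xd) ?ltrD2l // andbT; lra.
have xS i n : unit_sphere X (xs n i) by have [/(_ i)[]] := hxs n.
have /cvgr0_norm_lt/(_ eps eps0)[N _] := UC _ _ xS (fun=> erefl) lim f hf.
by move=> /(_ N (leqnn N)) /=; rewrite ltNge (ltW (hxs N).2).
Qed.

Theorem theorem3p20 (R : realType) (X : completeNormedModType R) (k : nat)
    (hk : (0 < k)%N) :
  ((exists r : R, [/\ 0 < r, r < 1 &
      kwSCh_on k (unit_sphere X) [set r *: x | x in unit_sphere X]]) ->
    kWLUR X k) /\
  ((exists r : R, [/\ 0 < r, r < 1 &
      kwSCh_on k (unit_sphere X) [set r *: x | x in unit_sphere X]]) <->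
    (forall C : set X, C !=set0 -> boundedly_compact C ->
      0 < dist_pt 0 C -> kwUC k (unit_sphere X) C)).
Proof.
split; [|split] => [[r [r0 r1 H]]|[r [r0 r1 H]] C _ bC C0|H].
- exact/kwFace_kWLUR/(kwSCh_kwFace r0 r1 H).
- exact/kwFace_kwUC/C0/bC/(kwSCh_kwFace r0 r1 H).
(* Any radius in [(0, 1)] would serve. *)
- have r0 : (0 : R) < 2^-1 by rewrite invr_gt0 ltr0n.
  have r1 : (2^-1 : R) < 1 by lra.
  by exists 2^-1; split => //; exact: kwUC_kwSCh.
Qed.
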